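(* Let $\Omega\subset\mathbb{R}^n$ and $\bar x\in\Omega$. Suppose there are a neighborhood $\mathcal{O}$ of $\bar x$, a mapping $f:\mathbb{R}^n\to\mathbb{R}^m$ twice differentiable at $\bar x$, and a closed set $\Theta\subset\mathbb{R}^m$ such that $\Omega\cap\mathcal{O}=\{x\in\mathcal{O}: f(x)\in\Theta\}$. Suppose that there are $\kappa>0$ and a neighborhood $U$ of $\bar x$ with $$\operatorname{dist}(x;\Omega)\le\kappa\,\operatorname{dist}(f(x);\Theta)\quad\text{for all }x\in U$$ (the metric subregularity constraint qualification), and that $\Theta$ is normally regular at $f(\bar x)$. Then for all $w\in T_\Omega(\bar x)$ we have $$u\in T^2_\Omega(\bar x,w)\iff \nabla f(\bar x)u+\nabla^2f(\bar x)(w,w)\in T^2_\Theta\big(f(\bar x),\nabla f(\bar x)w\big).$$ If furthermore, for such a $w$, the set $\Theta$ is parabolically derivable at $f(\bar x)$ for $\nabla f(\bar x)w$, then $\Omega$ is parabolically derivable at $\bar x$ for $w$.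
   Context: $\nabla^2f(\bar x)(w,v)=(\langle\nabla^2f_1(\bar x)w,v\rangle,\dots,\langle\nabla^2f_m(\bar x)w,v\rangle)$. Tangent cone: $T_\Omega(\bar x)=\{w:\exists t_k\downarrow0,\ w_k\to w,\ \bar x+t_kw_k\in\Omega\}$. Regular normal cone: $\widehat N_\Omega(\bar x)=\{v:\limsup_{x\to\bar x,\,x\in\Omega,\,x\neq\bar x}\frac{\langle v,x-\bar x\rangle}{\|x-\bar x\|}\le0\}$. Limiting normal cone: $N_\Omega(\bar x)=\{v:\exists x_k\to\bar x,\ x_k\in\Omega,\ v_k\to v,\ v_k\in\widehat N_\Omega(x_k)\}$. A set is normally regular at a point if $\widehat N=N$ there. Second-order tangent set: $T^2_\Omega(\bar x,w)=\{u:\exists t_k\downarrow0,\ u_k\to u,\ \bar x+t_kw+\tfrac12t_k^2u_k\in\Omega\}$. $\Omega$ is parabolically derivable at $\bar x$ for $w$ if $T^2_\Omega(\bar x,w)\ne\emptyset$ and for each $u\in T^2_\Omega(\bar x,w)$ there are $\varepsilon>0$ and an arc $\xi:[0,\varepsilon]\to\Omega$ with $\xi(0)=\bar x$, $\xi'_+(0)=w$ and $\xi''_+(0):=\lim_{t\downarrow0}\frac{\xi(t)-\xi(0)-t\xi'_+(0)}{\frac12t^2}=u$, where $\xi'_+(0)$ is the right derivative at $0$. *)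

(* Defs.v *)
From mathcomp Require Export all_boot all_order all_algebra.
From mathcomp Require Export all_classical all_reals all_analysis.
Export Order.TTheory GRing.Theory Num.Theory.
Export numFieldNormedType.Exports.

Set Implicit Arguments.
Unset Strict Implicit.
Unset Printing Implicit Defensive.

Local Open Scope classical_set_scope.
Local Open Scope ring_scope.

(* The library norm of 'rV[R]_n is the sup norm, which has the same topology as
   the Euclidean norm. Limits, neighborhoods and differentials below are the
   library ones; norms and distances written explicitly are Euclidean. *)

Definition dotp (R : realType) (n : nat) (u v : 'rV[R]_n) : R :=
  \sum_(i < n) u 0 i * v 0 i.

Definition enorm (R : realType) (n : nat) (u : 'rV[R]_n) : R :=
  Num.sqrt (dotp u u).

(* Since [inf set0 = 0], this is the distance only when A is nonempty. *)
Definition dist (R : realType) (n : nat) (x : 'rV[R]_n) (A : set 'rV[R]_n) : R :=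
  inf [set enorm (x - y) | y in A].

Definition gradient (R : realType) (n : nat) (g : 'rV[R]_n -> R)
    (x : 'rV[R]_n) : 'rV[R]_n :=
  \row_(j < n) 'd g x (delta_mx 0 j).

(* Vectors are rows, so the Hessian applied to w is [w *m hessian g x], which is
   the differential of the gradient at x in the direction w. *)
Definition hessian (R : realType) (n : nat) (g : 'rV[R]_n -> R)
    (x : 'rV[R]_n) : 'M[R]_n :=
  'J (gradient g) x.

Definition hess_form (R : realType) (n m : nat) (f : 'rV[R]_n -> 'rV[R]_m)
    (x w v : 'rV[R]_n) : 'rV[R]_m :=
  \row_(i < m) dotp (w *m hessian (fun y => f y 0 i) x) v.

Definition twice_differentiable (R : realType) (n m : nat)
    (f : 'rV[R]_n -> 'rV[R]_m) (x : 'rV[R]_n) : Prop :=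
  (\forall y \near x, differentiable f y) /\
  differentiable ((fun y => 'J f y) : 'rV[R]_n -> 'M[R]_(n, m)) x.

Definition tangent_cone (R : realType) (n : nat) (A : set 'rV[R]_n)
    (x : 'rV[R]_n) : set 'rV[R]_n :=
  [set w | exists (t : nat -> R) (w_ : nat -> 'rV[R]_n),
    [/\ forall k, 0 < t k, t @ \oo --> (0 : R), w_ @ \oo --> w &
        forall k, A (x + t k *: w_ k)]].

(* The filter [within A x^'] is y -> x with y in A and y != x. If x is isolated
   in A, the upper limit is -oo and every v is a regular normal. *)
Definition regular_normal_cone (R : realType) (n : nat) (A : set 'rV[R]_n)
    (x : 'rV[R]_n) : set 'rV[R]_n :=
  [set v | (limf_esup (fun y : 'rV[R]_n => (dotp v (y - x) / enorm (y - x))%:E)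
              (within A x^') <= 0)%E].

Definition limiting_normal_cone (R : realType) (n : nat) (A : set 'rV[R]_n)
    (x : 'rV[R]_n) : set 'rV[R]_n :=
  [set v | exists (x_ v_ : nat -> 'rV[R]_n),
    [/\ x_ @ \oo --> x, forall k, A (x_ k), v_ @ \oo --> v &
        forall k, regular_normal_cone A (x_ k) (v_ k)]].

Definition normally_regular (R : realType) (n : nat) (A : set 'rV[R]_n)
    (x : 'rV[R]_n) : Prop :=
  regular_normal_cone A x = limiting_normal_cone A x.

Definition second_order_tangent (R : realType) (n : nat) (A : set 'rV[R]_n)
    (x w : 'rV[R]_n) : set 'rV[R]_n :=
  [set u | exists (t : nat -> R) (u_ : nat -> 'rV[R]_n),
    [/\ forall k, 0 < t k, t @ \oo --> (0 : R), u_ @ \oo --> u &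
        forall k, A (x + t k *: w + (2^-1 * t k ^+ 2) *: u_ k)]].

(* Only the values of the arc xi on [0, e] matter. *)
Definition parabolically_derivable (R : realType) (n : nat) (A : set 'rV[R]_n)
    (x w : 'rV[R]_n) : Prop :=
  second_order_tangent A x w !=set0 /\
  forall u, second_order_tangent A x w u ->
    exists (e : R) (xi : R -> 'rV[R]_n),
      [/\ 0 < e,
          forall t, 0 <= t <= e -> A (xi t),
          xi 0 = x,
          t^-1 *: (xi t - xi 0) @[t --> (0 : R)^'+] --> w &
          (2^-1 * t ^+ 2)^-1 *: (xi t - xi 0 - t *: w) @[t --> (0 : R)^'+]
            --> u].

(* Main.v *)
From HB Require Import structures.
Require Import Defs.
From mathcomp Require Import ring.

(* A second-order Taylor expansion shows that, along x + t w + (t^2/2) v(t) with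
   v(t) -> u, the map f follows
     f(x) + t df(x)w + (t^2/2) (df(x)u + d2f(x)(w,w) + o(1)),
   which gives the direct implication. Conversely, if f(x) + t df(x)w + (t^2/2) y(t)
   lies in Theta with y(t) -> df(x)u + d2f(x)(w,w), then f(x + t w + (t^2/2) u) is
   o(t^2)-close to Theta, so by metric subregularity a near-projection of
   x + t w + (t^2/2) u onto Omega moves it only by o(t^2). Running the same estimate
   from x + t w, with an arbitrary second-order tangent of Theta, yields a displacement
   O(t^2); a cluster point of the displacements rescaled by 2/t^2 is a second-order
   tangent of Omega, hence nonemptiness. *)

Set Implicit Arguments.
Unset Strict Implicit.
Unset Printing Implicit Defensive.

Local Open Scope classical_set_scope.
Local Open Scope ring_scope.

(** * Coordinates, inner product, and comparison of the sup and Euclidean norms *)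

Lemma norm_coord_le (R : realType) (n : nat) (v : 'rV[R]_n) (i : 'I_n) :
  `|v 0 i| <= `|v|.
Proof.
rewrite [leRHS]/Num.norm /= mx_normrE.
by apply/bigmax_geP; right => /=; exists (0, i).
Qed.

Lemma norm_le_coord (R : realType) (n : nat) (v : 'rV[R]_n) (e : R) :
  0 <= e -> (forall i, `|v 0 i| <= e) -> `|v| <= e.
Proof.
move=> e0 ve; rewrite [leLHS]/Num.norm /= mx_normrE.
by apply/bigmax_leP; split=> // -[j i] _ /=; rewrite ord1.
Qed.

Lemma cvg_row (R : realType) (n : nat) (T : Type) (F : set_system T)
    {FF : Filter F} (u : T -> 'rV[R]_n) (l : 'rV[R]_n) :
  (forall i, u t 0 i @[t --> F] --> l 0 i) -> u @ F --> l.
Proof.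
move=> ul; apply/cvgrPdist_le => e e0.
have H : \forall t \near F, forall i, `|l 0 i - u t 0 i| <= e.
  by apply: filter_forall => i; move/cvgrPdist_le: (ul i); exact.
apply: filterS H => t Ht; apply: norm_le_coord => [|i]; first exact: ltW.
by rewrite !mxE.
Qed.

Lemma dotpZl (R : realType) (n : nat) (a : R) (u v : 'rV[R]_n) :
  dotp (a *: u) v = a * dotp u v.
Proof. by rewrite /dotp mulr_sumr; apply: eq_bigr => i _; rewrite mxE mulrA. Qed.

Lemma dotpZr (R : realType) (n : nat) (a : R) (u v : 'rV[R]_n) :
  dotp u (a *: v) = a * dotp u v.
Proof.
by rewrite /dotp mulr_sumr; apply: eq_bigr => i _; rewrite mxE mulrCA.
Qed.

Lemma dotpBl (R : realType) (n : nat) (u1 u2 v : 'rV[R]_n) :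
  dotp (u1 - u2) v = dotp u1 v - dotp u2 v.
Proof.
by rewrite /dotp -sumrB; apply: eq_bigr => i _; rewrite !mxE mulrBl.
Qed.

Lemma normr_dotp_le (R : realType) (n : nat) (u v : 'rV[R]_n) :
  `|dotp u v| <= n%:R * (`|u| * `|v|).
Proof.
apply: le_trans (ler_norm_sum _ _ _) _.
apply: (le_trans (y := \sum_(i < n) (`|u| * `|v|))).
  by apply: ler_sum => i _; rewrite normrM ler_pM ?norm_coord_le.
by rewrite sumr_const card_ord mulr_natl.
Qed.

Lemma cvg_dotp (R : realType) (n : nat) (T : Type) (F : set_system T)
    {FF : Filter F} (u v : T -> 'rV[R]_n) (l k : 'rV[R]_n) :
  u @ F --> l -> v @ F --> k -> dotp (u t) (v t) @[t --> F] --> dotp l k.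
Proof.
move=> ul vk; rewrite /dotp; apply: cvg_big => [|i _]; first exact: add_continuous.
have c (w : T -> 'rV[R]_n) (p : 'rV[R]_n) :
    w @ F --> p -> w t 0 i @[t --> F] --> p 0 i.
  move=> wp; apply: (cvg_comp w (fun M : 'rV[R]_n => M 0 i) wp).
  exact: coord_continuous.
by apply: cvgM; exact: c.
Qed.

Lemma enorm_ge_norm (R : realType) (n : nat) (u : 'rV[R]_n) : `|u| <= enorm u.
Proof.
apply: norm_le_coord => [|i]; first exact: sqrtr_ge0.
rewrite -sqrtr_sqr ler_wsqrtr // /dotp (bigD1 i) //= -expr2 lerDl.
by apply: sumr_ge0 => j _; rewrite -expr2 sqr_ge0.
Qed.

(** The sharp constant is $\sqrt n$; the cruder [n.+1] avoids a root, through $n\le(n+1)^2$. *)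
Lemma enorm_le_norm (R : realType) (n : nat) (u : 'rV[R]_n) :
  enorm u <= n.+1%:R * `|u|.
Proof.
have h0 : 0 <= n.+1%:R * `|u| by rewrite mulr_ge0.
rewrite -(ger0_norm h0) -sqrtr_sqr ler_wsqrtr //.
apply: le_trans (ler_norm _) _; apply: le_trans (normr_dotp_le _ _) _.
rewrite exprMn -expr2 ler_wpM2r ?sqr_ge0 // -natrX ler_nat.
by rewrite expnS -[leqLHS]mul1n leq_mul // expn1.
Qed.

(** * Gradients and first-order expansions *)

Lemma gradientE (R : realType) (n : nat) (g : 'rV[R]_n -> R) (x h : 'rV[R]_n) :
  'd g x h = dotp (gradient g x) h.
Proof.
rewrite {1}[h]row_sum_delta linear_sum /dotp; apply: eq_bigr => j _.
by rewrite linearZ /= mxE mulrC.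
Qed.

Lemma diff_expansion (R : realType) (V W : normedModType R) (f : V -> W)
    (x : V) : differentiable f x ->
  forall e, 0 < e ->
    \forall h \near (0 : V), `|f (h + x) - f x - 'd f x h| <= e * `|h|.
Proof.
move=> /diff_locally df e e0.
have /eqaddoP := df; move=> /(_ _ e0).
by apply: filterS => h; rewrite /= opprD addrA.
Qed.

(** The expansion of [f] at [x] is also one for [g], so by uniqueness of the differential ['d g x]
    is ['d f x]. *)
Lemma near_eq_differentiable (R : realType) (V W : normedModType R)
    (f g : V -> W) (x : V) :
  {near x, f =1 g} -> differentiable f x -> differentiable g x.
Proof.
move=> fg df.
have exg : g \o shift x = cst (g x) + 'd f x +o_ (0 : V) id.
  apply/eqaddoP => e e0; have := diff_expansion df e0.
  have fg0 : \forall h \near (0 : V), f (h + x) = g (h + x).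
    by move: fg; rewrite (near_shift 0) /=; apply: filterS => h; rewrite subr0.
  apply: filterS2 fg0 => h /= -> .
  by rewrite /= (nbhs_singleton fg) opprD addrA.
have dfc : continuous ('d f x) by exact: diff_continuous.
have dgE := diff_unique dfc exg.
by apply/diff_locallyP; rewrite dgE.
Qed.

(** * Second-order Taylor expansion of a scalar function *)

Lemma is_derive_line_minus_quadratic (R : realType) (n : nat)
    (g : 'rV[R]_n -> R) (x h : 'rV[R]_n) (d p q s : R) :
  differentiable g (s *: h + x) -> 'd g (s *: h + x) h = d ->
  is_derive s 1 (fun t : R => g (t *: h + x) - t * p - (2^-1 * t ^+ 2) * q)
    (d - p - s * q).
Proof.
move=> dg dE.
have dl : is_diff s (fun t : R => t *: h + x) (fun t : R => t *: h).
  by apply: is_diff_eq; rewrite addr0.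
have dgl : is_derive s 1 (fun t : R => g (t *: h + x)) d.
  have ? : differentiable (fun t : R => t *: h + x) s by case: dl.
  apply: DeriveDef; first by apply: diff_derivable; exact: differentiable_comp.
  by rewrite deriveE; [rewrite diff_comp //= diff_val scale1r
    |exact: differentiable_comp].
clear dE.
apply: is_derive_eq.
by rewrite /GRing.scale /=; field.
Qed.

(* Apply the mean value theorem to [s |-> g (x + s h) - s <G x, h> - s^2/2 <D h, h>]
   on [0, 1]: its derivative is controlled by the first-order expansion of [G]
   at x. *)
Lemma taylor2_of_gradient (R : realType) (n : nat) (g : 'rV[R]_n -> R)
    (G : 'rV[R]_n -> 'rV[R]_n) (D : {linear 'rV[R]_n -> 'rV[R]_n})
    (x : 'rV[R]_n) :
  (\forall y \near x, differentiable g y /\ forall h, 'd g y h = dotp (G y) h) ->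
  (forall e, 0 < e -> \forall h \near (0 : 'rV[R]_n),
    `|G (h + x) - G x - D h| <= e * `|h|) ->
  forall e, 0 < e -> \forall h \near (0 : 'rV[R]_n),
    `|g (h + x) - g x - dotp (G x) h - 2^-1 * dotp (D h) h| <= e * `|h| ^+ 2.
Proof.
move=> dg dG e e0.
(* The divisor absorbs the dimension factor of [normr_dotp_le]; [n.+1] keeps it nonzero when [n] is
   0. *)
have e1 : 0 < e / n.+1%:R by rewrite divr_gt0.
have := dG _ e1 => /nbhs_ballP[r1 /= r10 Hr1].
have := dg; rewrite (near_shift 0) /= => /nbhs_ballP[r2 /= r20 Hr2].
apply/nbhs_ballP; exists (Num.min r1 r2); first by rewrite /= lt_min r10.
move=> h; rewrite -ball_normE /= sub0r normrN lt_min => /andP[hr1 hr2].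
pose phi (s : R) :=
  g (s *: h + x) - s * dotp (G x) h - (2^-1 * s ^+ 2) * dotp (D h) h.
pose dphi (s : R) := dotp (G (s *: h + x)) h - dotp (G x) h - s * dotp (D h) h.
have sh (s : R) r : 0 <= s <= 1 -> `|h| < r -> `|s *: h| < r.
  move=> /andP[s0 s1]; apply: le_lt_trans.
  by rewrite normrZ ger0_norm // ler_piMl.
have dphiE (s : R) : 0 <= s <= 1 -> is_derive s 1 phi (dphi s).
  move=> s01.
  have [] : differentiable g (s *: h + x) /\
      forall k, 'd g (s *: h + x) k = dotp (G (s *: h + x)) k.
    have := Hr2 (s *: h); rewrite -ball_normE /= sub0r normrN subr0.
    by apply; exact: sh.
  by move=> dgs /(_ h) dE; exact: is_derive_line_minus_quadratic.
have [c c01] : exists2 c, c \in `[0, 1]%R & phi 1 - phi 0 = dphi c * (1 - 0).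
  apply: MVT_segment => //.
    move=> s; rewrite in_itv /= => /andP[/ltW s0 /ltW s1].
    by apply: dphiE; rewrite s0.
  apply: derivable_within_continuous => s; rewrite in_itv /= => s01.
  by have [] := dphiE _ s01.
move: c01; rewrite in_itv /= => c01.
rewrite subr0 mulr1 /phi scale1r scale0r add0r => E.
have -> : g (h + x) - g x - dotp (G x) h - 2^-1 * dotp (D h) h = dphi c.
  rewrite -E; move: (g (h + x)) (g x) (dotp (G x) h) (dotp _ h) => a b p q.
  by ring.
(* By linearity of [D], the derivative at [c] pairs [h] with the first-order remainder of [G] at
   [c *: h], which is at most a small multiple of $|h|$. *)
have -> : dphi c = dotp (G (c *: h + x) - G x - D (c *: h)) h.
  by rewrite linearZ !dotpBl dotpZl.
apply: le_trans (normr_dotp_le _ _) _.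
have /= := Hr1 (c *: h).
rewrite -ball_normE /= sub0r normrN => /(_ (sh _ _ c01 hr1)) H.
apply: (le_trans (y := n.+1%:R * (e / n.+1%:R * `|h| * `|h|))).
  apply: ler_pM => //; first by rewrite ler_nat.
  apply: ler_wpM2r => //; apply: (le_trans H).
  apply: ler_wpM2l; first exact: ltW.
  by rewrite normrZ; case/andP: c01 => c0 c1; rewrite ger0_norm // ler_piMl.
by rewrite le_eqVlt; apply/orP; left; apply/eqP; field.
Qed.

Lemma taylor2 (R : realType) (n : nat) (g : 'rV[R]_n -> R) (x : 'rV[R]_n) :
  (\forall y \near x, differentiable g y) -> differentiable (gradient g) x ->
  forall e, 0 < e -> \forall h \near (0 : 'rV[R]_n),
    `|g (h + x) - g x - dotp (gradient g x) h
      - 2^-1 * dotp ('d (gradient g) x h) h| <= e * `|h| ^+ 2.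
Proof.
move=> dg dG; apply: taylor2_of_gradient; last exact: diff_expansion.
by apply: filterS dg => y dgy; split => // h; exact: gradientE.
Qed.

(** * Second-order quotients along parabolic curves *)

Lemma dotpDr (R : realType) (n : nat) (u v1 v2 : 'rV[R]_n) :
  dotp u (v1 + v2) = dotp u v1 + dotp u v2.
Proof.
by rewrite /dotp -big_split; apply: eq_bigr => i _; rewrite !mxE mulrDr.
Qed.

(** The curve is $x+h$ with $h=ta$ and $a=w+\frac t2v\to w$. On the scale $t^2/2$ the Taylor
    polynomial, less its constant and $t\langle p,w\rangle$, is exactly $\langle p,v\rangle+\langle
    Da,a\rangle$, and the remainder is $o(|h|^2)=o(t^2)$. A general filter covers both sequences and
    the one-sided limit $t\downarrow0$. *)
Lemma cvg_second_order_quotient (R : realType) (n : nat) (g : 'rV[R]_n -> R)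
    (p : 'rV[R]_n) (D : {linear 'rV[R]_n -> 'rV[R]_n}) (x w : 'rV[R]_n)
    (T : Type) (F : set_system T) {FF : Filter F}
    (t : T -> R) (v : T -> 'rV[R]_n) (u : 'rV[R]_n) :
  continuous D ->
  (forall e, 0 < e -> \forall h \near (0 : 'rV[R]_n),
    `|g (h + x) - g x - dotp p h - 2^-1 * dotp (D h) h| <= e * `|h| ^+ 2) ->
  (\forall s \near F, 0 < t s) -> t @ F --> (0 : R) -> v @ F --> u ->
  (2^-1 * t s ^+ 2)^-1 *
    (g (x + t s *: w + (2^-1 * t s ^+ 2) *: v s) - g x - t s * dotp p w)
    @[s --> F] --> dotp p u + dotp (D w) w.
Proof.
move=> Dc taylor t0 tc vc.
pose a s := w + (2^-1 * t s) *: v s.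
have ac : a @ F --> w.
  rewrite -[X in _ --> X]addr0 -(scale0r u) -(mulr0 2^-1).
  apply: cvgD; first exact: cvg_cst.
  by apply: cvgZ => //; apply: cvgM => //; exact: cvg_cst.
pose h s := t s *: a s.
have hc : h @ F --> (0 : 'rV[R]_n) by rewrite -(scale0r w); exact: cvgZ.
pose r s := g (h s + x) - g x - dotp p (h s) - 2^-1 * dotp (D (h s)) (h s).
have rc : (2^-1 * t s ^+ 2)^-1 * r s @[s --> F] --> (0 : R).
  apply/cvgr0Pnorm_le => e e0.
  pose b := `|w| + 1.
  have b0 : 0 < b by rewrite ltr_wpDl.
  (* Since $|h|\le tb$ eventually, this constant bounds the remainder by $e\,t^2/2$. *)
  have e1 : 0 < e / (2 * b ^+ 2) by rewrite divr_gt0 // mulr_gt0 ?exprn_gt0.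
  have Hr := hc _ (taylor _ e1).
  have ab : \forall s \near F, `|a s| <= b.
    by apply: (cvgr_norm_le (F := F) w ac); rewrite ltrDl.
  near=> s.
  have ts : 0 < t s by near: s.
  have asb : `|a s| <= b by near: s.
  have : `|r s| <= e / (2 * b ^+ 2) * `|h s| ^+ 2 by near: s; exact: Hr.
  rewrite normrM gtr0_norm; last by rewrite invr_gt0 mulr_gt0 ?invr_gt0 ?exprn_gt0.
  rewrite ler_pdivrMl; last by rewrite mulr_gt0 ?invr_gt0 ?exprn_gt0.
  move/le_trans; apply.
  rewrite /h normrZ exprMn gtr0_norm //.
  have -> : 2^-1 * t s ^+ 2 * e = e / (2 * b ^+ 2) * (t s ^+ 2 * b ^+ 2).
    by field; rewrite gt_eqF.
  rewrite ler_wpM2l ?(ltW e1) // ler_wpM2l ?sqr_ge0 //.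
  by rewrite lerXn2r ?nnegrE // ltW.
have H : dotp p (v s) + dotp (D (a s)) (a s) + (2^-1 * t s ^+ 2)^-1 * r s
    @[s --> F] --> dotp p u + dotp (D w) w.
  rewrite -[X in _ --> X]addr0; apply: cvgD rc; apply: cvgD.
    by apply: cvg_dotp => //; exact: cvg_cst.
  by apply: cvg_dotp => //; apply: (cvg_comp a D ac); exact: Dc.
apply: cvg_trans H; apply: near_eq_cvg; near=> s.
have ts : 0 < t s by near: s.
have tsn : t s != 0 by rewrite gt_eqF.
have -> : x + t s *: w + (2^-1 * t s ^+ 2) *: v s = h s + x.
  rewrite /h /a scalerDr scalerA -addrA addrC; congr (_ + _ *: _ + _).
  by rewrite expr2 mulrCA.
have phE : dotp p (h s) = t s * dotp p w + (2^-1 * t s ^+ 2) * dotp p (v s).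
  by rewrite /h /a dotpZr dotpDr dotpZr; ring.
have DhE : dotp (D (h s)) (h s) = t s ^+ 2 * dotp (D (a s)) (a s).
  by rewrite /h linearZ dotpZl dotpZr mulrA -expr2.
rewrite /r phE DhE.
move: (g (h s + x)) (g x) (dotp p w) (dotp p (v s)) (dotp _ _) => b1 b2 b3 b4 b5.
by field.
Unshelve. all: by end_near. Qed.

(** Chain rule with a coordinate map, which is linear and continuous, hence its own differential. *)
Lemma diff_coord (R : realType) (n m : nat) (f : 'rV[R]_n -> 'rV[R]_m)
    (y : 'rV[R]_n) (i : 'I_m) : differentiable f y ->
  differentiable (fun z => f z 0 i) y /\
  forall h, 'd (fun z => f z 0 i) y h = ('d f y h) 0 i.
Proof.
move=> df.
pose c (v : 'rV[R]_m) : R := v 0 i.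
have cl : linear c by move=> k u v; rewrite /c !mxE.
pose cL : {linear 'rV[R]_m -> R} := HB.pack c (GRing.isLinear.Build _ _ _ _ _ cl).
have cc : continuous cL by exact: coord_continuous.
have dc z : differentiable cL z by exact: linear_differentiable.
split; first by apply: (differentiable_comp df (dc _)).
move=> h; have -> : (fun z => f z 0 i) = cL \o f by [].
by rewrite (diff_comp df (dc _)) (diff_lin _ cc).
Qed.

(** The gradient of a component is a transposed column of the Jacobian wherever [f] is
    differentiable. This is known only near [x], hence the appeal to [near_eq_differentiable]. *)
Lemma differentiable_gradient_coord (R : realType) (n m : nat)
    (f : 'rV[R]_n -> 'rV[R]_m) (x : 'rV[R]_n) (i : 'I_m) :
  twice_differentiable f x ->
  differentiable (gradient (fun z => f z 0 i)) x.
Proof.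
move=> [df dJ].
pose c (M : 'M[R]_(n, m)) : 'rV[R]_n := (col i M)^T.
have cl : linear c by move=> k u v; apply/rowP => j; rewrite !mxE.
pose cL : {linear 'M[R]_(n, m) -> 'rV[R]_n} :=
  HB.pack c (GRing.isLinear.Build _ _ _ _ _ cl).
have cc : continuous cL.
  move=> M; apply: (cvg_row (F := nbhs M)) => j; rewrite /= /c.
  under eq_fun do rewrite !mxE.
  by rewrite !mxE; exact: coord_continuous.
have dc z : differentiable cL z by exact: linear_differentiable.
apply: near_eq_differentiable (differentiable_comp dJ (dc _)).
apply: filterS df => y dfy; apply/rowP => j.
have [_ E] := diff_coord i dfy.
by rewrite /= /c !mxE E.
Qed.

Lemma hess_formE (R : realType) (n m : nat) (f : 'rV[R]_n -> 'rV[R]_m)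
    (x w v : 'rV[R]_n) (i : 'I_m) :
  hess_form f x w v 0 i = dotp ('d (gradient (fun y => f y 0 i)) x w) v.
Proof. by rewrite mxE /hessian /jacobian mul_rV_lin1. Qed.

Lemma cvg_second_order (R : realType) (n m : nat) (f : 'rV[R]_n -> 'rV[R]_m)
    (x w : 'rV[R]_n) (T : Type) (F : set_system T) {FF : Filter F}
    (t : T -> R) (v : T -> 'rV[R]_n) (u : 'rV[R]_n) :
  twice_differentiable f x ->
  (\forall s \near F, 0 < t s) -> t @ F --> (0 : R) -> v @ F --> u ->
  (2^-1 * t s ^+ 2)^-1 *:
    (f (x + t s *: w + (2^-1 * t s ^+ 2) *: v s) - f x - t s *: 'd f x w)
    @[s --> F] --> 'd f x u + hess_form f x w w.
Proof.
move=> f2 t0 tc vc; apply: cvg_row => i.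
have [dfx _] := f2.
pose g y := f y 0 i.
have dg : \forall y \near x, differentiable g y.
  by apply: filterS dfx => y /(diff_coord i)[].
have dG : differentiable (gradient g) x by exact: differentiable_gradient_coord.
have dE h : 'd f x h 0 i = dotp (gradient g x) h.
  by have [_ <-] := diff_coord i (nbhs_singleton dfx); exact: gradientE.
rewrite mxE hess_formE dE.
under eq_fun do rewrite !mxE dE.
apply: (cvg_second_order_quotient (g := g)) => //; last exact: taylor2.
exact: diff_continuous.
Qed.

(** * Near-projections and sequences of tangents *)

Lemma dist_le (R : realType) (n : nat) (x y : 'rV[R]_n) (A : set 'rV[R]_n) :
  A y -> dist x A <= enorm (x - y).
Proof.
move=> Ay; apply: ge_inf; last by exists y.
by exists 0 => _ [z _ <-]; exact: sqrtr_ge0.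
Qed.

(** A nearest point may fail to exist when [A] is not closed, so points almost attaining the infimum
    are chosen, with the tolerance as an argument. For [e <= 0] the value is a fixed point of [A],
    so that membership always holds. *)
Lemma near_projection (R : realType) (n : nat) (A : set 'rV[R]_n) :
  A !=set0 -> exists p : 'rV[R]_n -> R -> 'rV[R]_n, forall x e,
    A (p x e) /\ (0 < e -> enorm (x - p x e) <= dist x A + e).
Proof.
move=> [a Aa].
suff /choice[p H] : forall xe : 'rV[R]_n * R, exists z, A z /\
    (0 < xe.2 -> enorm (xe.1 - z) <= dist xe.1 A + xe.2).
  by exists (fun x e => p (x, e)) => x e; exact: H (x, e).
move=> [x e] /=; have [e0|e0] := ltP 0 e; last by exists a.
have hasinf : has_inf [set enorm (x - y) | y in A].
  by split; [exists (enorm (x - a)), a|exists 0 => _ [z _ <-]; exact: sqrtr_ge0].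
have [_ [z Az <-] zlt] := inf_adherent e0 hasinf.
by exists z; split => // _; exact: ltW.
Qed.

(** Dropping finitely many terms turns eventual conditions into the conditions at every index that
    the definition asks for. *)
Lemma second_order_tangent_near (R : realType) (n : nat) (A : set 'rV[R]_n)
    (x w u : 'rV[R]_n) (t : nat -> R) (v : nat -> 'rV[R]_n) :
  (\forall k \near \oo, 0 < t k) -> t @ \oo --> (0 : R) -> v @ \oo --> u ->
  (\forall k \near \oo, A (x + t k *: w + (2^-1 * t k ^+ 2) *: v k)) ->
  second_order_tangent A x w u.
Proof.
move=> t0 tc vc At; have [N _ HN] := filterI t0 At.
exists (fun k => t (k + N)%N), (fun k => v (k + N)%N); split.
- by move=> k; have [] := HN (k + N)%N (leq_addl _ _).
- by rewrite (cvg_shiftn N t).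
- by rewrite (cvg_shiftn N v).
- by move=> k; have [] := HN (k + N)%N (leq_addl _ _).
Qed.

(** A cluster point exists by compactness of closed balls. The indices satisfy [j <= k j]; they tend
    to infinity but need not increase. *)
Lemma bounded_subsequence (R : realType) (n : nat) (r : nat -> 'rV[R]_n) (M : R) :
  (\forall k \near \oo, `|r k| <= M) ->
  exists (k : nat -> nat) (u : 'rV[R]_n), k @ \oo --> \oo /\ r \o k @ \oo --> u.
Proof.
move=> rM.
have bcomp : compact [set v : 'rV[R]_n | `|v| <= M].
  apply: bounded_closed_compact.
    by exists M; split; [exact: num_real|move=> B MB v /le_trans; apply; exact: ltW].
  rewrite (_ : [set v | _] = (@Num.norm R 'rV[R]_n) @^-1` [set y | y <= M]) //.
  apply: preimage_closed; last exact: closed_le.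
  by move=> v _; exact: norm_continuous.
have [u [_ clu]] := bcomp (r @ \oo) _ rM.
have /choice[k Hk] : forall j, exists k, (j <= k)%N /\ `|u - r k| < j.+1%:R^-1.
  move=> j.
  have Fj : (r @ \oo) (r @` [set k | (j <= k)%N]).
    by exists j => // i /= ji; exists i.
  have Bj : nbhs u (ball u (j.+1%:R^-1 : R)) by apply: nbhsx_ballx; rewrite invr_gt0.
  have [_ [[k /= jk <-]]] := clu _ _ Fj Bj.
  by rewrite -ball_normE /= => rk; exists k.
exists k, u; split.
  by move=> P [N _ HN]; exists N => // j /= Nj; apply: HN => /=;
    apply: leq_trans Nj (Hk j).1.
apply/cvgrPdist_lt => e e0.
have /cvgr0Pnorm_lt/(_ _ e0) := @cvg_harmonic R.
apply: filterS => j /=; rewrite gtr0_norm ?invr_gt0 // => je.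
exact: lt_trans (Hk j).2 je.
Qed.

(** * Metric subregularity along parabolic curves *)

Lemma cvg_parabola (R : realType) (n : nat) (x w u : 'rV[R]_n) (T : Type)
    (F : set_system T) {FF : Filter F} (t : T -> R) (v : T -> 'rV[R]_n) :
  t @ F --> (0 : R) -> v @ F --> u ->
  x + t s *: w + (2^-1 * t s ^+ 2) *: v s @[s --> F] --> x.
Proof.
move=> tc vc.
rewrite [X in _ --> X](_ : x = x + 0 *: w + (2^-1 * 0 ^+ 2) *: u); last first.
  by rewrite expr2 !mulr0 !scale0r !addr0.
apply: cvgD; first by apply: cvgD; [exact: cvg_cst|exact: cvgZr_tmp].
by apply: cvgZ => //; apply: cvgM; [exact: cvg_cst|exact: (cvgM tc tc)].
Qed.

(* [p] is the near-projection onto Omega and the left-hand side is the gap, on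
   the scale t^2/2, between the curve x + t w + (t^2/2) v and Omega. *)
Lemma subregularity_gap (R : realType) (n m : nat)
    (Omega : set 'rV[R]_n) (Theta : set 'rV[R]_m)
    (f : 'rV[R]_n -> 'rV[R]_m) (x w : 'rV[R]_n) (z b : 'rV[R]_m) (kappa : R)
    (p : 'rV[R]_n -> R -> 'rV[R]_n)
    (T : Type) (F : set_system T) {FF : Filter F}
    (t : T -> R) (v : T -> 'rV[R]_n) (u : 'rV[R]_n) (y : T -> 'rV[R]_m) :
  0 < kappa ->
  (\forall c \near x, dist c Omega <= kappa * dist (f c) Theta) ->
  (forall c e, 0 < e -> enorm (c - p c e) <= dist c Omega + e) ->
  (\forall s \near F, 0 < t s) -> t @ F --> (0 : R) -> v @ F --> u ->
  (\forall s \near F, Theta (z + t s *: b + (2^-1 * t s ^+ 2) *: y s)) ->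
  \forall s \near F,
    `|(2^-1 * t s ^+ 2)^-1 *:
       (p (x + t s *: w + (2^-1 * t s ^+ 2) *: v s) (t s ^+ 3)
        - (x + t s *: w + (2^-1 * t s ^+ 2) *: v s))|
    <= kappa * (m.+1%:R *
        `|(2^-1 * t s ^+ 2)^-1 *:
           (f (x + t s *: w + (2^-1 * t s ^+ 2) *: v s) - z - t s *: b) - y s|)
      + 2 * t s.
Proof.
move=> k0 sub pE t0 tc vc Ty.
pose c s := x + t s *: w + (2^-1 * t s ^+ 2) *: v s.
have cc : c @ F --> x by exact: cvg_parabola tc vc.
have subc := cc _ sub.
near=> s; rewrite -/(c s).
have ts : 0 < t s by near: s.
have h0 : 0 < 2^-1 * t s ^+ 2 by rewrite mulr_gt0 ?invr_gt0 ?exprn_gt0.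
have Tys : Theta (z + t s *: b + (2^-1 * t s ^+ 2) *: y s) by near: s.
have subs : dist (c s) Omega <= kappa * dist (f (c s)) Theta by near: s.
set h := 2^-1 * t s ^+ 2 in h0 Tys *.
rewrite normrZ gtr0_norm ?invr_gt0 // ler_pdivrMl // -normrN opprB.
apply: le_trans (enorm_ge_norm _) _.
apply: le_trans (pE _ _ _) _; first by rewrite exprn_gt0.
(* The tolerance [t s ^+ 3] of the near-projection is [h] times [2 * t s], thus negligible on the
   scale $t^2/2$. *)
have -> : h * (kappa * (m.+1%:R * `|h^-1 *: (f (c s) - z - t s *: b) - y s|)
    + 2 * t s) =
  kappa * (m.+1%:R * (h * `|h^-1 *: (f (c s) - z - t s *: b) - y s|)) + t s ^+ 3.
  by rewrite /h; field.
rewrite lerD2r; apply: le_trans subs _; rewrite ler_wpM2l ?(ltW k0) //.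
(* The given point of [Theta] bounds the distance; [m.+1] is the cost of returning to the sup
   norm. *)
apply: le_trans (dist_le _ Tys) _; apply: le_trans (enorm_le_norm _) _.
have -> : f (c s) - (z + t s *: b + h *: y s) =
    h *: (h^-1 *: (f (c s) - z - t s *: b) - y s).
  by rewrite scalerBr scalerKV ?gt_eqF // !opprD !addrA.
by rewrite normrZ (gtr0_norm h0).
Unshelve. all: by end_near. Qed.

(** Here [y] and the second-order quotient of [f] along the curve share their limit, so the bound of
    [subregularity_gap] tends to 0: projecting does not change the second-order term [u]. *)
Lemma cvg_projected_arc (R : realType) (n m : nat)
    (Omega : set 'rV[R]_n) (Theta : set 'rV[R]_m)
    (f : 'rV[R]_n -> 'rV[R]_m) (x w : 'rV[R]_n) (kappa : R)
    (p : 'rV[R]_n -> R -> 'rV[R]_n)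
    (T : Type) (F : set_system T) {FF : Filter F}
    (t : T -> R) (u : 'rV[R]_n) (y : T -> 'rV[R]_m) :
  twice_differentiable f x -> 0 < kappa ->
  (\forall c \near x, dist c Omega <= kappa * dist (f c) Theta) ->
  (forall c e, 0 < e -> enorm (c - p c e) <= dist c Omega + e) ->
  (\forall s \near F, 0 < t s) -> t @ F --> (0 : R) ->
  y @ F --> 'd f x u + hess_form f x w w ->
  (\forall s \near F,
     Theta (f x + t s *: 'd f x w + (2^-1 * t s ^+ 2) *: y s)) ->
  (2^-1 * t s ^+ 2)^-1 *:
    (p (x + t s *: w + (2^-1 * t s ^+ 2) *: u) (t s ^+ 3) - x - t s *: w)
    @[s --> F] --> u.
Proof.
move=> f2 k0 sub pE t0 tc yc Ty.
have uc : (fun=> u) @ F --> u by exact: cvg_cst.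
have gap := subregularity_gap (FF := FF) w k0 sub pE t0 tc uc Ty.
have qc := cvg_second_order (FF := FF) (w := w) f2 t0 tc uc.
set c := fun s => x + t s *: w + (2^-1 * t s ^+ 2) *: u.
have gc : (2^-1 * t s ^+ 2)^-1 *: (p (c s) (t s ^+ 3) - c s) @[s --> F]
    --> (0 : 'rV[R]_n).
  apply/cvgr0Pnorm_le => e e0.
  have bc : kappa * (m.+1%:R *
      `|(2^-1 * t s ^+ 2)^-1 *: (f (c s) - f x - t s *: 'd f x w) - y s|)
      + 2 * t s @[s --> F] --> (0 : R).
    have -> : 0 = kappa * (m.+1%:R * 0) + 2 * 0 :> R by rewrite !mulr0 addr0.
    apply: cvgD; last by apply: cvgM => //; exact: cvg_cst.
    apply: cvgM; first exact: cvg_cst.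
    apply: cvgM; first exact: cvg_cst.
    rewrite -[X in _ --> X](@normr0 _ 'rV[R]_m); apply: cvg_norm.
    rewrite -(subrr ('d f x u + hess_form f x w w)).
    exact: (cvgB qc yc).
  have /cvgr0Pnorm_le/(_ _ e0) := bc.
  apply: filterS2 gap => s /le_trans + h; apply.
  exact: le_trans (ler_norm _) h.
have H : u + (2^-1 * t s ^+ 2)^-1 *: (p (c s) (t s ^+ 3) - c s) @[s --> F] --> u.
  by rewrite -[X in _ --> X]addr0; apply: cvgD.
apply: cvg_trans H; apply: near_eq_cvg; near=> s.
have ts : 0 < t s by near: s.
have h0 : 2^-1 * t s ^+ 2 != 0 by rewrite gt_eqF // mulr_gt0 ?invr_gt0 ?exprn_gt0.
rewrite /c; set h := 2^-1 * t s ^+ 2 in h0 *; set q := p _ _.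
rewrite -[X in X + _](scalerK h0 u) -scalerDr; congr (_ *: _).
by rewrite addrC opprD addrA addrNK opprD addrA.
Unshelve. all: by end_near. Qed.

(** * Transfer of second-order tangents between the two sets *)

Lemma addDBBK (U : zmodType) (a b c : U) : a + b + (c - a - b) = c.
Proof. by rewrite -(addrA c) -opprD subrKC. Qed.

Lemma second_order_tangent_image (R : realType) (n m : nat)
    (Omega : set 'rV[R]_n) (Theta : set 'rV[R]_m)
    (f : 'rV[R]_n -> 'rV[R]_m) (x w u : 'rV[R]_n) :
  twice_differentiable f x ->
  (\forall c \near x, Omega c -> Theta (f c)) ->
  second_order_tangent Omega x w u ->
  second_order_tangent Theta (f x) ('d f x w) ('d f x u + hess_form f x w w).
Proof.
move=> f2 fO [t [v [t0 tc vc Ov]]].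
have t0' : \forall k \near \oo, 0 < t k by exact: nearW.
have qc := cvg_second_order (FF := eventually_filter) (w := w) f2 t0' tc vc.
(* The witnesses are the second-order quotients of [f]: rescaled by $t^2/2$, they give back [f]
   along the curve. *)
apply: (second_order_tangent_near t0' tc qc).
have xc : x + t k *: w + (2^-1 * t k ^+ 2) *: v k @[k --> \oo] --> x.
  exact: cvg_parabola tc vc.
have fOk : \forall k \near \oo,
    Omega (x + t k *: w + (2^-1 * t k ^+ 2) *: v k) ->
    Theta (f (x + t k *: w + (2^-1 * t k ^+ 2) *: v k)) by exact: xc _ fO.
apply: filterS fOk => k /= /(_ (Ov k)).
rewrite scalerKV; last by rewrite gt_eqF // mulr_gt0 ?invr_gt0 ?exprn_gt0.
by rewrite addDBBK.
Qed.

Lemma second_order_tangent_nonempty (R : realType) (n m : nat)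
    (Omega : set 'rV[R]_n) (Theta : set 'rV[R]_m)
    (f : 'rV[R]_n -> 'rV[R]_m) (x w : 'rV[R]_n) (kappa : R)
    (p : 'rV[R]_n -> R -> 'rV[R]_n) :
  twice_differentiable f x -> 0 < kappa ->
  (\forall c \near x, dist c Omega <= kappa * dist (f c) Theta) ->
  (forall c e, Omega (p c e)) ->
  (forall c e, 0 < e -> enorm (c - p c e) <= dist c Omega + e) ->
  second_order_tangent Theta (f x) ('d f x w) !=set0 ->
  second_order_tangent Omega x w !=set0.
Proof.
move=> f2 k0 sub pO pE [z [t [y [t0 tc yc Ty]]]].
have t0' : \forall k \near \oo, 0 < t k by exact: nearW.
have Ty' : \forall k \near \oo,
    Theta (f x + t k *: 'd f x w + (2^-1 * t k ^+ 2) *: y k) by exact: nearW.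
have vc : (fun=> 0 : 'rV[R]_n) @ \oo --> (0 : 'rV[R]_n) by exact: cvg_cst.
have gap := subregularity_gap (FF := eventually_filter) w k0 sub pE t0' tc vc Ty'.
have qc := cvg_second_order (FF := eventually_filter) (w := w) f2 t0' tc vc.
pose c k := x + t k *: w + (2^-1 * t k ^+ 2) *: (0 : 'rV[R]_n).
pose r k := (2^-1 * t k ^+ 2)^-1 *: (p (c k) (t k ^+ 3) - c k).
(* The tangent [z] is arbitrary, so this limit of the discrepancy may be nonzero and only
   boundedness of [r] is available. In the bound below, $|L|+1$ holds eventually and the final 2
   comes from $t\le1$. *)
pose L := 'd f x 0 + hess_form f x w w - z.
have rM : \forall k \near \oo, `|r k| <= kappa * (m.+1%:R * (`|L| + 1)) + 2.
  have Qc : (2^-1 * t k ^+ 2)^-1 *: (f (c k) - f x - t k *: 'd f x w) - y k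
      @[k --> \oo] --> L by exact: cvgB.
  have Qb : \forall k \near \oo,
      `|(2^-1 * t k ^+ 2)^-1 *: (f (c k) - f x - t k *: 'd f x w) - y k| <= `|L| + 1.
    by apply: (cvgr_norm_le (F := \oo) L Qc); rewrite ltrDl.
  have tb : \forall k \near \oo, `|t k| <= 1.
    by apply: (cvgr_norm_le (F := \oo) 0 tc); rewrite normr0.
  near=> k; apply: (le_trans (near gap k _)) => //.
  apply: lerD.
    by rewrite ler_wpM2l ?(ltW k0) // ler_wpM2l //; near: k.
  rewrite -[leRHS]mulr1 ler_wpM2l //; apply: le_trans (ler_norm _) _.
  by near: k.
have [k [u [koo uc]]] := bounded_subsequence rM.
exists u, (t \o k), (r \o k); split => //.
- by move=> j; exact: t0.
- exact: cvg_comp koo tc.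
move=> j /=; rewrite /r scalerKV; last first.
  by rewrite gt_eqF // mulr_gt0 ?invr_gt0 ?exprn_gt0.
have -> : c (k j) = x + t (k j) *: w by rewrite /c scaler0 addr0.
by rewrite addrC addrNK.
Unshelve. all: by end_near. Qed.

Theorem theorem4p5 (R : realType) (n m : nat)
    (Omega : set 'rV[R]_n) (xbar : 'rV[R]_n) (V : set 'rV[R]_n)
    (f : 'rV[R]_n -> 'rV[R]_m) (Theta : set 'rV[R]_m)
    (xbarOmega : Omega xbar)
    (nbhsV : nbhs xbar V)
    (f2 : twice_differentiable f xbar)
    (closedTheta : closed Theta)
    (OmegaV : Omega `&` V = [set x | V x /\ Theta (f x)])
    (mscq : exists kappa : R, 0 < kappa /\
       exists U : set 'rV[R]_n, nbhs xbar U /\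
         forall x, U x -> dist x Omega <= kappa * dist (f x) Theta)
    (regTheta : normally_regular Theta (f xbar)) :
  forall w : 'rV[R]_n, tangent_cone Omega xbar w ->
    (forall u : 'rV[R]_n,
       second_order_tangent Omega xbar w u <->
       second_order_tangent Theta (f xbar) ('d f xbar w)
         ('d f xbar u + hess_form f xbar w w)) /\
    (parabolically_derivable Theta (f xbar) ('d f xbar w) ->
     parabolically_derivable Omega xbar w).
Proof.
move=> w _.
have [kappa [k0 [U [nU HU]]]] := mscq.
have sub : \forall c \near xbar, dist c Omega <= kappa * dist (f c) Theta.
  exact: filterS nU.
have fO : \forall c \near xbar, Omega c -> Theta (f c).
  apply: filterS nbhsV => c Vc Oc.
  by have [] : [set x | V x /\ Theta (f x)] c by rewrite -OmegaV.
have [p pP] : exists p : 'rV[R]_n -> R -> 'rV[R]_n, forall x e,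
    Omega (p x e) /\ (0 < e -> enorm (x - p x e) <= dist x Omega + e).
  by apply: near_projection; exists xbar.
have pO c e : Omega (p c e) by exact: (pP c e).1.
have pE c e : 0 < e -> enorm (c - p c e) <= dist c Omega + e by exact: (pP c e).2.
have fwd u := second_order_tangent_image (w := w) (u := u) f2 fO.
split=> [u|].
  split; first exact: fwd.
  move=> [t [y [t0 tc yc Ty]]].
  have t0' : \forall k \near \oo, 0 < t k by exact: nearW.
  have Ty' : \forall k \near \oo, Theta
      (f xbar + t k *: 'd f xbar w + (2^-1 * t k ^+ 2) *: y k) by exact: nearW.
  have uc := cvg_projected_arc (FF := eventually_filter) f2 k0 sub pE t0' tc yc Ty'.
  apply: (second_order_tangent_near t0' tc uc); apply: nearW => k.
  (* The witnesses are rescaled so that each point of the sequence is a near-projection, hence in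
     [Omega]. *)
  rewrite scalerKV; last by rewrite gt_eqF // mulr_gt0 ?invr_gt0 ?exprn_gt0.
  set q := p _ _.
  by rewrite addDBBK; exact: pO.
move=> [neTheta arcs]; split.
  exact: second_order_tangent_nonempty f2 k0 sub pO pE neTheta.
(* The arc [xi] in [Theta] realizes the image of [u]; its second-order quotient will serve as [y] in
   [cvg_projected_arc], along $t\downarrow0$. *)
move=> u /fwd /arcs [e [xi [e0 xiT xi0 _ xi2]]].
pose q (t : R) := xbar + t *: w + (2^-1 * t ^+ 2) *: u.
(* At [t = 0] the tolerance vanishes and [p] returns an uncontrolled point of [Omega], so the value
   [xbar] is imposed. *)
pose zeta (t : R) := if t == 0 then xbar else p (q t) (t ^+ 3).
have zeta0 : zeta 0 = xbar by rewrite /zeta eqxx.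
have t0 : \forall t \near (0 : R)^'+, 0 < t by exact: nbhs_right_gt.
have tc : (id : R -> R) @ (0 : R)^'+ --> (0 : R).
  by apply: cvg_at_right_filter; exact: cvg_id.
have zeta2 : (2^-1 * t ^+ 2)^-1 *: (zeta t - zeta 0 - t *: w) @[t --> (0 : R)^'+]
    --> u.
  have Ty : \forall t \near (0 : R)^'+,
      Theta (f xbar + id t *: 'd f xbar w + (2^-1 * id t ^+ 2) *:
        ((2^-1 * t ^+ 2)^-1 *: (xi t - xi 0 - t *: 'd f xbar w))).
    near=> t.
    have tgt0 : 0 < t by near: t.
    rewrite scalerKV /=; last by rewrite gt_eqF // mulr_gt0 ?invr_gt0 ?exprn_gt0.
    rewrite xi0 addDBBK; apply: xiT.
    by rewrite ltW //=; near: t; exact: nbhs_right_le.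
  have H := cvg_projected_arc (FF := at_right_proper_filter (0 : R))
    f2 k0 sub pE t0 tc xi2 Ty.
  apply: cvg_trans H; apply: near_eq_cvg; near=> t.
  have tgt0 : 0 < t by near: t.
  by rewrite zeta0 /zeta gt_eqF.
(* Any positive length would do, as [zeta] takes all its values in [Omega]. *)
exists 1, zeta; split => //.
- by move=> t _; rewrite /zeta; case: ifP.
(* The first-order quotient is $w$ plus $t/2$ times the convergent second-order one, so the right
   derivative follows from [zeta2]. *)
- have H : w + (2^-1 * t) *: ((2^-1 * t ^+ 2)^-1 *: (zeta t - zeta 0 - t *: w))
      @[t --> (0 : R)^'+] --> w.
    rewrite -[X in _ --> X]addr0; apply: cvgD; first exact: cvg_cst.
    rewrite -(scale0r u); apply: cvgZ => //.
    by rewrite -[X in _ --> X](mulr0 2^-1); apply: cvgM => //; exact: cvg_cst.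
  apply: cvg_trans H; apply: near_eq_cvg; near=> t.
  have tgt0 : 0 < t by near: t.
  rewrite scalerA.
  have -> : 2^-1 * t * (2^-1 * t ^+ 2)^-1 = t^-1 by field; rewrite gt_eqF.
  by rewrite scalerBr scalerK ?gt_eqF // addrC addrNK.
Unshelve. all: by end_near. Qed.
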